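(* Let $\mathscr{V}$ be a finite set, let $F:2^{\mathscr{V}}\to\mathbb{R}$ be a non-decreasing set function with $F(\emptyset)=0$. Let $n_p,q,l,\widehat{l},\widetilde{l}\ge1$ be integers, $k=ql$, $\widehat{k}=q\widehat{l}$, $\widetilde{k}=q\widetilde{l}$, with $k\le\min(\widehat{k},\widetilde{k})$. Then any set $\mathscr{A}^{\text{d-bg}}_{[n_p,\widetilde{k}]}$ output by the distributed batch greedy algorithm (for maximizing $F(\mathscr{A})$ subject to $|\mathscr{A}|\le k$) satisfies $$F\left(\mathscr{A}^{\text{d-bg}}_{[n_p,\widetilde{k}]}\right)\ \ge\ \left(1-e^{-\eta_{\mathscr{V},q}\,\gamma_{\mathscr{V},\widehat{k}}\,(\widetilde{l}/\widehat{l})}\right)\left(1-e^{-\eta_{\mathscr{V},q}\,\gamma_{\mathscr{V},k}\,(\widehat{l}/l)}\right)\frac{\gamma_{\mathscr{V},k}}{k}\max_{\mathscr{B}\subseteq\mathscr{V},\,|\mathscr{B}|\le k}F(\mathscr{B}),$$ where $\gamma_{\mathscr{V},k},\gamma_{\mathscr{V},\widehat{k}}$ are submodularity ratios and $\eta_{\mathscr{V},q}$ is the supermodularity ratio of $F$.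
   Context: Incremental gain: for $\mathscr{A},\mathscr{B}\subseteq\mathscr{V}$, $\rho_{\mathscr{A}}(\mathscr{B})=F(\mathscr{A}\cup\mathscr{B})-F(\mathscr{B})$, and $\rho_\nu(\mathscr{B})=\rho_{\{\nu\}}(\mathscr{B})$. Submodularity ratio: $\gamma_{\mathscr{V},k}=\min\frac{\sum_{\nu\in\mathscr{A}}\rho_\nu(\mathscr{B})}{\rho_{\mathscr{A}}(\mathscr{B})}$; supermodularity ratio: $\eta_{\mathscr{V},k}=\min\frac{\rho_{\mathscr{A}}(\mathscr{B})}{\sum_{\nu\in\mathscr{A}}\rho_\nu(\mathscr{B})}$; both minima are over $\mathscr{A},\mathscr{B}\subseteq\mathscr{V}$ with $|\mathscr{A}|\le k$, $\mathscr{A}\cap\mathscr{B}=\emptyset$, ignoring pairs for which the denominator is zero (value $1$ if no pair remains). Batch greedy with batch size $q$ for $L$ iterations on a ground set $\mathscr{W}\subseteq\mathscr{V}$: start with $\mathscr{A}=\emptyset$; in each of $L$ iterations add to $\mathscr{A}$ the $q$ elements $a$ of $\mathscr{W}\setminus\mathscr{A}$ with the highest incremental gains $\rho_a(\mathscr{A})$ (ties broken arbitrarily; if fewer than $q$ elements remain, add all of them). Distributed batch greedy algorithm: partition $\mathscr{V}$ into $n_p$ sets $\mathscr{V}_1,\dots,\mathscr{V}_{n_p}$. For each $i$, run batch greedy with batch size $q$ for $\widehat{l}$ iterations on $\mathscr{V}_i$ to obtain $\mathscr{A}^{\text{bg}}_{i,[n_p,\widehat{k}]}$. Let $\mathscr{M}=\bigcup_i\mathscr{A}^{\text{bg}}_{i,[n_p,\widehat{k}]}$.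 Run batch greedy with batch size $q$ for $\widetilde{l}$ iterations on $\mathscr{M}$; its result is the output $\mathscr{A}^{\text{d-bg}}_{[n_p,\widetilde{k}]}$. The output may have cardinality larger than $k$. *)

(* Defs.v *)
From mathcomp Require Import all_boot all_order all_algebra.
From mathcomp Require Import reals.

Set Implicit Arguments.
Unset Strict Implicit.
Unset Printing Implicit Defensive.

Import Order.TTheory GRing.Theory Num.Theory.
Local Open Scope ring_scope.

(* The ground set is the whole finite type T. *)

Definition gain (R : realType) (T : finType) (F : {set T} -> R)
    (A B : {set T}) : R :=
  F (A :|: B) - F B.

Definition sum_gain (R : realType) (T : finType) (F : {set T} -> R)
    (A B : {set T}) : R :=
  \sum_(v in A) gain F [set v] B.

Definition ratio_pair (R : realType) (T : finType)
    (den : {set T} -> {set T} -> R) (k : nat) (p : {set T} * {set T}) : bool :=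
  [&& (#|p.1| <= k)%N, [disjoint p.1 & p.2] & den p.1 p.2 != 0].

(* [pick] only supplies a starting admissible pair p0; the value is the
   minimum over all admissible pairs whatever p0 is. *)
Definition min_ratio (R : realType) (T : finType)
    (num den : {set T} -> {set T} -> R) (k : nat) : R :=
  let ratio := fun p : {set T} * {set T} => num p.1 p.2 / den p.1 p.2 in
  if [pick p | ratio_pair den k p] is Some p0
  then ratio [arg min_(p < p0 | ratio_pair den k p) ratio p]%O
  else 1.

Definition submod_ratio (R : realType) (T : finType) (F : {set T} -> R)
    (k : nat) : R :=
  min_ratio (sum_gain F) (gain F) k.

Definition supermod_ratio (R : realType) (T : finType) (F : {set T} -> R)
    (k : nat) : R :=
  min_ratio (gain F) (sum_gain F) k.

(* A relation rather than a function: each way of breaking ties gives one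
   possible successor A'. *)
Definition batch_step (R : realType) (T : finType) (F : {set T} -> R)
    (q : nat) (W A A' : {set T}) : Prop :=
  exists S : {set T},
    [/\ S \subset W :\: A,
        #|S| = minn q #|W :\: A|,
        (forall a b, a \in S -> b \in (W :\: A) :\: S ->
           gain F [set b] A <= gain F [set a] A)
      & A' = A :|: S].

Inductive batch_greedy (R : realType) (T : finType) (F : {set T} -> R)
    (q : nat) (W : {set T}) : nat -> {set T} -> Prop :=
| batch_greedy0 : batch_greedy F q W 0 set0
| batch_greedyS (L : nat) (A A' : {set T}) :
    batch_greedy F q W L A -> batch_step F q W A A' ->
    batch_greedy F q W L.+1 A'.

(* Blocks of the partition may be empty. *)
Definition indexed_partition (T : finType) (n : nat)
    (V : 'I_n -> {set T}) : Prop :=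
  \bigcup_i V i = [set: T] /\ forall i j, i != j -> [disjoint V i & V j].

Definition distributed_batch_greedy (R : realType) (T : finType)
    (F : {set T} -> R) (np q lhat ltilde : nat) (out : {set T}) : Prop :=
  exists V A : 'I_np -> {set T},
    [/\ indexed_partition V,
        forall i, batch_greedy F q (V i) lhat (A i)
      & batch_greedy F q (\bigcup_i A i) ltilde out].

Definition max_value_le_card (R : realType) (T : finType) (F : {set T} -> R)
    (k : nat) : R :=
  F [arg max_(B > set0 | (#|B| <= k)%N) F B]%O.

(* Main.v *)
Require Import Defs.
From mathcomp Require Import all_boot all_order all_algebra.
From mathcomp Require Import reals sequences.
From mathcomp Require Import exp lra.
Set Implicit Arguments.
Unset Strict Implicit.
Import Order.TTheory GRing.Theory Num.Theory.
Local Open Scope ring_scope.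

(** Both phases of the algorithm are batch greedy runs, and one estimate
    controls such a run.  Let [B] be a subset of the ground set with at most
    [q * m] elements, and let [S] be the batch added to the current set [A].
    The submodularity ratio bounds [F B - F A] by the sum of the single gains
    over [B :\: A]; that sum is at most [m] times the sum over [S], because
    [S] holds the [q] largest single gains ([sum_le_top_set]); the
    supermodularity ratio bounds the latter sum by the actual gain of [S].
    Each step thus closes a fraction [eta * gamma / m] of the distance to
    [F B] ([batch_step_progress]), and after [L] steps
    [F A >= (1 - exp (- eta * gamma * L / m)) * F B] ([batch_greedy_ge]).

    Let [O] be an optimal set with at most [k] elements.  By the
    submodularity ratio at the empty set, the best single element [o] of [O]
    has [F [set o] >= gamma / k * F O] ([exists_good_singleton]).  The local run
    on the block of [o] returns a set [A i] that competes with the single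
    element [o].  As [A i] has at most [khat] elements and lies in the union
    of the local results, the second run competes with [A i].  Chaining these
    three bounds yields the three factors of the theorem. *)

(** * Submodularity and supermodularity ratios *)

Section MinRatio.
Variables (R : realType) (T : finType) (num den : {set T} -> {set T} -> R).
Hypotheses (num_ge0 : forall A B, 0 <= num A B)
           (den_ge0 : forall A B, 0 <= den A B).

Lemma min_ratio_ge0 k : 0 <= min_ratio num den k.
Proof. by rewrite /min_ratio; case: pickP => // p0 _; apply: divr_ge0. Qed.

(** The product form of the ratio bound also covers the pairs that the minimum
    ignores: there the denominator, and with it the left-hand side, vanishes. *)
Lemma min_ratio_mul_le k (A B : {set T}) :
  (#|A| <= k)%N -> [disjoint A & B] -> min_ratio num den k * den A B <= num A B.
Proof.
move=> Ak dAB; have [->|dn0] := eqVneq (den A B) 0; first by rewrite mulr0.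
have pAB : ratio_pair den k (A, B) by rewrite /ratio_pair /= Ak dAB dn0.
rewrite -ler_pdivlMr ?lt_def ?dn0 ?den_ge0 // /min_ratio.
case: pickP => [p0 p0P|/(_ (A, B))]; last by rewrite pAB.
by case: arg_minP => // p _ /(_ _ pAB).
Qed.

End MinRatio.

(** * Sums over the largest values *)

(** If [Y] is not inside the top set [S], the largest value [t] taken on
    [Y :\: S] separates [S] from [Y :\: S].  Comparing the sums of [f - t]
    bounds the sum over [Y] by the sum over [S] plus [#|Y| - #|S|] copies of
    [t], at most [(m - 1) * #|S|] of them; each group of [#|S|] copies costs at
    most the sum over [S], since [t] is below every value taken on [S]. *)
Lemma sum_le_top_set (R : realType) (T : finType) (f : T -> R) (q m : nat)
    (X S Y : {set T}) :
  (forall x, 0 <= f x) -> (0 < m)%N ->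
  S \subset X -> #|S| = minn q #|X| ->
  (forall a b, a \in S -> b \in X :\: S -> f b <= f a) ->
  Y \subset X -> (#|Y| <= q * m)%N ->
  \sum_(y in Y) f y <= m%:R * \sum_(s in S) f s.
Proof.
move=> f0 m0 SX cS top YX cY.
have S0 : 0 <= \sum_(s in S) f s by apply: sumr_ge0.
have sum_subset (g : T -> R) (A B : {set T}) : A \subset B ->
    (forall x, x \in B -> 0 <= g x) ->
    \sum_(x in A) g x <= \sum_(x in B) g x.
  move=> AB g0; rewrite [leRHS](big_setID A) /= (setIidPr AB) lerDl sumr_ge0 //.
  by move=> x /setDP[/g0].
case: m m0 cY => // m _ cY; rewrite -(natr1 m) mulrDl mul1r.
have [YS|] := boolP (Y \subset S).
  apply: le_trans (sum_subset _ _ _ YS _) _; first by move=> *; apply: f0.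
  by rewrite lerDr mulr_ge0.
case/subsetPn=> b0 b0Y b0S; have b0P : b0 \in Y :\: S by rewrite inE b0S.
(* An element of [X] was left out, so [S] is a full batch. *)
have cSq : #|S| = q.
  have : (#|S| < #|X|)%N.
    apply/proper_card/properP; split=> //.
    by exists b0 => //; apply: (subsetP YX).
  by rewrite cS gtn_min ltnn orbF => /ltnW/minn_idPl.
have [b bP bmax] :
    exists2 b, b \in Y :\: S & forall y, y \in Y :\: S -> f y <= f b.
  by case: (arg_maxP f b0P) => b bP bmax; exists b.
have tS a : a \in S -> f b <= f a.
  move=> aS; apply: top => //; move: bP; rewrite !inE => /andP[-> bY].
  exact: (subsetP YX).
have sum_sub (A : {set T}) :
    \sum_(x in A) (f x - f b) = \sum_(x in A) f x - #|A|%:R * f b.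
  by rewrite sumrB sumr_const mulr_natl.
have key : \sum_(x in Y) (f x - f b) <= \sum_(x in S) (f x - f b).
  rewrite (big_setID S) /= -[leRHS]addr0; apply: lerD.
    by apply: sum_subset; [apply: subsetIr | move=> x /tS; rewrite subr_ge0].
  by apply: sumr_le0 => x /bmax; rewrite subr_le0.
have Sqt : q%:R * f b <= \sum_(x in S) f x.
  rewrite -cSq mulr_natl -sumr_const; exact: ler_sum.
have Yqt : #|Y|%:R * f b <= m%:R * (q%:R * f b) + q%:R * f b.
  rewrite mulrA -mulrDl; apply: ler_wpM2r => //.
  by rewrite -natrM -natrD ler_nat addnC mulnC -mulnS.
have mSqt := ler_wpM2l (ler0n R m) Sqt.
move: key; rewrite !sum_sub cSq; lra.
Qed.

(** * Batch greedy runs *)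

Section BatchGreedy.
Variables (R : realType) (T : finType) (F : {set T} -> R).
Hypothesis F_nondecreasing : forall A B : {set T}, A \subset B -> F A <= F B.

Lemma gain_ge0 (A B : {set T}) : 0 <= gain F A B.
Proof. by rewrite subr_ge0; apply/F_nondecreasing/subsetUr. Qed.

Lemma sum_gain_ge0 (A B : {set T}) : 0 <= sum_gain F A B.
Proof. by apply: sumr_ge0 => v _; apply: gain_ge0. Qed.

Lemma submod_ratio_ge0 k : 0 <= submod_ratio F k.
Proof. by apply: min_ratio_ge0 => A B; rewrite ?sum_gain_ge0 ?gain_ge0. Qed.

Lemma supermod_ratio_ge0 k : 0 <= supermod_ratio F k.
Proof. by apply: min_ratio_ge0 => A B; rewrite ?sum_gain_ge0 ?gain_ge0. Qed.

Lemma submod_ratioP k (A B : {set T}) : (#|A| <= k)%N -> [disjoint A & B] ->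
  submod_ratio F k * gain F A B <= sum_gain F A B.
Proof. by apply: min_ratio_mul_le => ? ?; rewrite ?sum_gain_ge0 ?gain_ge0. Qed.

Lemma supermod_ratioP k (A B : {set T}) : (#|A| <= k)%N -> [disjoint A & B] ->
  supermod_ratio F k * sum_gain F A B <= gain F A B.
Proof. by apply: min_ratio_mul_le => ? ?; rewrite ?sum_gain_ge0 ?gain_ge0. Qed.

Lemma batch_step_subset q (W A A' : {set T}) :
  batch_step F q W A A' -> A \subset A'.
Proof. by case=> S [_ _ _ ->]; apply: subsetUl. Qed.

Lemma batch_greedy_card q (W A : {set T}) L :
  batch_greedy F q W L A -> (#|A| <= q * L)%N.
Proof.
elim=> [|{}L {}A A' _ IH [S [_ cS _ ->]]]; first by rewrite cards0.
apply: leq_trans (leq_card_setU _ _).1 _.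
by rewrite mulnS addnC leq_add // cS geq_minl.
Qed.

(** This is where the two ratios meet: [gamma] passes from [F B - F A] to
    single gains, [eta] passes from single gains back to the gain of the
    batch. *)
Lemma batch_step_progress q m (W A A' B : {set T}) :
  (0 < m)%N -> batch_step F q W A A' -> B \subset W -> (#|B| <= q * m)%N ->
  supermod_ratio F q * submod_ratio F (q * m) * (F B - F A)
    <= m%:R * (F A' - F A).
Proof.
move=> m0 [S [SX cS top ->]] BW cB.
have cBA : (#|B :\: A| <= q * m)%N.
  by apply: leq_trans cB; rewrite subset_leq_card ?subsetDl.
have dBA : [disjoint B :\: A & A].
  by rewrite -setI_eq0 setIDAC setDIl setDv setI0.
have dSA : [disjoint S & A].
  by rewrite (disjointWl SX) // -setI_eq0 setIDAC setDIl setDv setI0.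
have toB : F B - F A <= gain F (B :\: A) A.
  apply: lerB => //; apply: F_nondecreasing; apply/subsetP=> x xB.
  by rewrite !inE xB andbT orNb.
have gammaB := submod_ratioP cBA dBA.
have topB : sum_gain F (B :\: A) A <= m%:R * sum_gain F S A.
  by apply: (@sum_le_top_set _ _ _ q m (W :\: A)) => // [x|];
     [apply: gain_ge0 | apply: setSD].
have etaS : supermod_ratio F q * sum_gain F S A <= F (A :|: S) - F A.
  rewrite setUC; apply: supermod_ratioP dSA; by rewrite cS geq_minl.
rewrite -mulrA.
apply: (@le_trans _ _ (supermod_ratio F q * (m%:R * sum_gain F S A))).
  apply: ler_wpM2l; first exact: supermod_ratio_ge0.
  apply: le_trans topB; apply: le_trans gammaB.
  by apply: ler_wpM2l toB; apply: submod_ratio_ge0.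
by rewrite mulrCA; apply: ler_wpM2l etaS.
Qed.

(** The deficit [F B - F A] shrinks by a factor [1 - c <= exp (- c)] at each
    step, where [c = eta * gamma / m], as long as it is nonnegative; once it
    is negative it stays so by monotonicity. *)
Lemma batch_greedy_ge q m L (W A B : {set T}) :
  F set0 = 0 -> (0 < m)%N -> batch_greedy F q W L A ->
  B \subset W -> (#|B| <= q * m)%N ->
  (1 - expR (- (supermod_ratio F q * submod_ratio F (q * m)
                * (L%:R / m%:R)))) * F B <= F A.
Proof.
move=> F0 m0 run BW cB; have mR0 : (0 < m%:R :> R) by rewrite ltr0n.
have FB0 : 0 <= F B by rewrite -F0; apply/F_nondecreasing/sub0set.
set e := supermod_ratio F q * _; pose c := e / m%:R.
have -> : e * (L%:R / m%:R) = c *+ L.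
  by rewrite -[RHS]mulr_natr mulrA [RHS]mulrAC.
suff : F B - F A <= expR (- (c *+ L)) * F B by lra.
elim: run => [|{}L {}A A' _ IH step].
  by rewrite F0 subr0 oppr0 expR0 mul1r.
have AA' := F_nondecreasing (batch_step_subset step).
have prog : c * (F B - F A) <= F A' - F A.
  rewrite /c mulrAC ler_pdivrMr // [leRHS]mulrC.
  exact: batch_step_progress m0 step BW cB.
have [D0|Dlt0] := leP 0 (F B - F A); last first.
  apply: le_trans (_ : 0 <= _); first by lra.
  by rewrite mulr_ge0 // expR_ge0.
rewrite mulrS opprD expRD -mulrA.
apply: le_trans (_ : expR (- c) * (F B - F A) <= _); last first.
  by apply: ler_wpM2l IH; apply: expR_ge0.
apply: le_trans (_ : (1 + - c) * (F B - F A) <= _); first by lra.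
by apply: (ler_wpM2r D0); apply: expR_ge1Dx.
Qed.

(** * Choosing a competitor for the local runs *)

Lemma exists_good_singleton k (B : {set T}) :
  F set0 = 0 -> (#|B| <= k)%N -> B != set0 ->
  exists o, submod_ratio F k / k%:R * F B <= F [set o].
Proof.
move=> F0 cB /set0Pn[o0 o0B].
have k0 : (0 < k)%N by apply: leq_trans cB; apply/card_gt0P; exists o0.
have := @submod_ratioP k B set0 cB; rewrite -setI_eq0 setI0 eqxx => /(_ isT).
rewrite /gain setU0 F0 subr0 /sum_gain => le_sum.
case: (arg_maxP (fun o => F [set o]) o0B) => o _ omax; exists o.
rewrite mulrAC ler_pdivrMr ?ltr0n //; apply: le_trans le_sum _.
apply: (@le_trans _ _ (\sum_(v in B) F [set o])).
  by apply: ler_sum => v /omax; rewrite /gain setU0 F0 subr0.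
rewrite sumr_const -[leLHS]mulr_natr; apply: ler_wpM2l; last by rewrite ler_nat.
by rewrite -F0; apply/F_nondecreasing/sub0set.
Qed.

End BatchGreedy.

Theorem theorem3p2 (R : realType) (T : finType) (F : {set T} -> R)
  (F_nondecreasing : forall A B : {set T}, A \subset B -> F A <= F B)
  (F_set0 : F set0 = 0)
  (np q l lhat ltilde k khat ktilde : nat)
  (np_ge1 : (1 <= np)%N) (q_ge1 : (1 <= q)%N) (l_ge1 : (1 <= l)%N)
  (lhat_ge1 : (1 <= lhat)%N) (ltilde_ge1 : (1 <= ltilde)%N)
  (k_def : k = (q * l)%N) (khat_def : khat = (q * lhat)%N)
  (ktilde_def : ktilde = (q * ltilde)%N)
  (k_le : (k <= minn khat ktilde)%N)
  (out : {set T})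
  (out_dbg : distributed_batch_greedy F np q lhat ltilde out) :
  F out >=
    (1 - expR (- (supermod_ratio F q * submod_ratio F khat
                  * (ltilde%:R / lhat%:R))))
    * (1 - expR (- (supermod_ratio F q * submod_ratio F k
                    * (lhat%:R / l%:R))))
    * (submod_ratio F k / k%:R)
    * max_value_le_card F k.
Proof.
have factor_ge0 s (a b : nat) :
    0 <= 1 - expR (- (supermod_ratio F q * submod_ratio F s * (a%:R / b%:R))).
  rewrite subr_ge0 -[leRHS]expR0 ler_expR oppr_le0
          !mulr_ge0 ?invr_ge0 ?ler0n //;
    by [apply: (supermod_ratio_ge0 F_nondecreasing)
       |apply: (submod_ratio_ge0 F_nondecreasing)].
have c0 : (#|@set0 T| <= k)%N by rewrite cards0.
rewrite /max_value_le_card.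
case: (@arg_maxP _ _ _ set0 (fun B : {set T} => (#|B| <= k)%N) F c0) => B cB _.
have [->|B0] := eqVneq B set0; first by rewrite F_set0 mulr0 -F_set0;
  apply/F_nondecreasing/sub0set.
have [o o_good] := exists_good_singleton F_nondecreasing F_set0 cB B0.
case: out_dbg => V [A [[covV _] runA run]].
have [i _ oi] : exists2 i, true & o \in V i.
  by apply/bigcupP; rewrite covV inE.
have global : (1 - expR (- (supermod_ratio F q * submod_ratio F khat
                  * (ltilde%:R / lhat%:R)))) * F (A i) <= F out.
  rewrite khat_def.
  apply: (batch_greedy_ge F_nondecreasing F_set0 lhat_ge1 run).
    exact: bigcup_sup.
  exact: batch_greedy_card (runA i).
have local : (1 - expR (- (supermod_ratio F q * submod_ratio F k
                  * (lhat%:R / l%:R)))) * F [set o] <= F (A i).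
  rewrite k_def; apply: (batch_greedy_ge F_nondecreasing F_set0 l_ge1 (runA i)).
    by rewrite sub1set.
  by rewrite cards1 muln_gt0 q_ge1.
move: (factor_ge0 khat ltilde lhat) (factor_ge0 k lhat l) global local.
move: (1 - expR (- (_ * _ * (ltilde%:R / _)))) => a.
move: (1 - expR (- (_ * _ * (lhat%:R / _)))) => b a0 b0 global local.
rewrite -!mulrA; apply: le_trans (ler_wpM2l a0 _) global.
by apply: le_trans (ler_wpM2l b0 _) local; rewrite mulrA.
Qed.
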